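(* Let $\alpha>0$. There are $M\geq 1$ and a connected simple (locally finite) graph $G=(E,V)$, with $V=\mathbb{N}$ and $n\sim n+1$ for all $n\in\mathbb{N}$, such that $n^{-\alpha}|d_G(n)-d_G(n+1)|\leq M$ for all $n\in\mathbb{N}^*$ and such that $\eta(\mathcal{A}_G)=+\infty$.
   Context: $\mathbb{N}$ is the set of non-negative integers and $\mathbb{N}^*$ the set of positive integers. A graph $G=(E,V)$ consists of a countable set $V$ and a symmetric weight function $E:V\times V\to[0,\infty)$ with no loops ($E(x,x)=0$). Write $x\sim y$ if $E(x,y)\neq 0$. The degree is $d_G(x):=|\{y\in V: E(x,y)\ne 0\}|$; $G$ is locally finite if all degrees are finite. $G$ is simple if $E$ takes values in $\{0,1\}$; it is connected if any two vertices are joined by a finite path of successive neighbors. The Hilbert space is the complex space $\ell^2(V)$, and $\mathcal{C}_c(G)$ is the set of finitely supported functions $V\to\mathbb{C}$. The adjacency matrix is the symmetric operator $(\mathcal{A}_{G,\circ}f)(x):=\sum_{y\sim x}E(x,y)f(y)$ for $f\in\mathcal{C}_c(G)$, with closure $\mathcal{A}_G$. Its deficiency indices $\dim\ker((\mathcal{A}_G)^*\mp \mathrm{i})\in\mathbb{N}\cup\{+\infty\}$ are equal because $\mathcal{A}_G$ commutes with complex conjugation; $\eta(\mathcal{A}_G)$ denotes their common value. *)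

(* Defs.v *)
From mathcomp Require Import all_boot all_order all_algebra.
From mathcomp Require Import finmap complex.
From mathcomp Require Import mathcomp_extra boolp classical_sets functions.
From mathcomp Require Import cardinality fsbigop reals ereal numfun esum exp.

Set Implicit Arguments.
Unset Strict Implicit.
Unset Printing Implicit Defensive.

Import Order.TTheory GRing.Theory Num.Theory.

Local Open Scope classical_set_scope.
Local Open Scope ring_scope.
Local Open Scope complex_scope.

Section Graphs.
Variable R : realType.

Record wgraph (V : countType) := WGraph {
  weight :> V -> V -> R;
  weight_ge0 : forall x y, 0 <= weight x y;
  weight_sym : forall x y, weight x y = weight y x;
  weight_loop : forall x, weight x x = 0
}.

Variables (V : countType) (G : wgraph V).

Definition adjacent (x y : V) : bool := G x y != 0.

Definition neighbors (x : V) : set V := [set y | adjacent x y].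

(* Meaningful only when [neighbors x] is finite: [fset_set] is empty on infinite
   sets. *)
Definition degree (x : V) : nat := #|` fset_set (neighbors x)|%N.

Definition graph_locally_finite : Prop := forall x, finite_set (neighbors x).

Definition graph_simple : Prop := forall x y, G x y = 0 \/ G x y = 1.

Definition graph_connected : Prop :=
  forall x y, exists s : seq V, path adjacent x s /\ last x s = y.

End Graphs.

Section Hilbert.
Variables (R : realType) (V : countType).
Implicit Types (f g : V -> R[i]) (z : R[i]).

Definition sqnorm f : \bar R := \esum_(x in setT) (ComplexField.Normc.normc (f x) ^+ 2)%:E.

Definition l2 : set (V -> R[i]) := [set f | (sqnorm f < +oo)%E].

(* The sum of an absolutely summable family, as the difference of the sums of its
   positive and negative parts. *)
Definition rsum (u : V -> R) : R :=
  fine (\esum_(x in setT) ((EFin \o u)^\+ x)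
        - \esum_(x in setT) ((EFin \o u)^\- x))%E.

Definition csum (u : V -> R[i]) : R[i] :=
  rsum (fun x => complex.Re (u x)) +i* rsum (fun x => complex.Im (u x)).

Definition inner f g : R[i] := csum (fun x => f x * (g x)^*).

(* A possibly unbounded operator on l2(V) is represented by its graph: [T (f, h)]
   means that f is in the domain of T and T f = h. *)
Definition operator := set ((V -> R[i]) * (V -> R[i])).

Definition op_closure (T : operator) : operator :=
  [set p | [/\ l2 p.1, l2 p.2 &
    forall e : R, 0 < e -> exists2 q, T q &
      (sqnorm (fun x => (p.1 x - q.1 x)%R) < e%:E)%E /\
      (sqnorm (fun x => (p.2 x - q.2 x)%R) < e%:E)%E]].

Definition op_adjoint (T : operator) : operator :=
  [set p | [/\ l2 p.1, l2 p.2 &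
    forall q, T q -> inner q.2 p.1 = inner q.1 p.2]].

(* ker (T - z) *)
Definition op_ker (T : operator) z : set (V -> R[i]) :=
  [set f | T (f, fun x => z * f x)].

Definition lin_indep n (v : 'I_n -> V -> R[i]) : Prop :=
  forall c : 'I_n -> R[i],
    (forall x, \sum_(i < n) c i * v i x = 0) -> forall i, c i = 0.

Definition dimension (K : set (V -> R[i])) : \bar R :=
  ereal_sup [set (n%:R%:E)%E | n in [set n : nat |
    exists v : 'I_n -> V -> R[i], lin_indep v /\ forall i, K (v i)]].

Definition finitely_supported : set (V -> R[i]) :=
  [set f | finite_set [set x | f x != 0]].

Variable G : wgraph R V.

Definition adjacency_fun f : V -> R[i] :=
  fun x => \sum_(y \in neighbors G x) (G x y)%:C * f y.

Definition adjacency0 : operator :=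
  [set p | finitely_supported p.1 /\ p.2 = adjacency_fun p.1].

Definition adjacency : operator := op_closure adjacency0.

Definition deficiency z : \bar R := dimension (op_ker (op_adjoint adjacency) z).

(* The common value of the two deficiency indices; see [eta_conj]. *)
Definition eta : \bar R := deficiency 'i.

End Hilbert.

Section Conjugation.
Variables (R : realType) (V : countType).
Implicit Types (f g : V -> R[i]) (z : R[i]) (T : operator R V).

Definition conjf f : V -> R[i] := fun x => (f x)^*.

Lemma conjfK f : conjf (conjf f) = f.
Proof. by apply/funext => x; rewrite /conjf conjcK. Qed.

Lemma sqnorm_conj f : sqnorm (conjf f) = sqnorm f.
Proof.
apply: eq_esum => x _; rewrite /conjf; case: (f x) => a b /=.
by rewrite sqrrN.
Qed.

Lemma sqnorm_conjB f g :
  sqnorm (fun x => conjf f x - conjf g x) = sqnorm (fun x => f x - g x).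
Proof.
rewrite -[RHS]sqnorm_conj; congr sqnorm; apply/funext => x.
by rewrite /conjf rmorphB.
Qed.

Lemma l2_conj f : l2 f -> l2 (conjf f).
Proof. by rewrite /l2 /= sqnorm_conj. Qed.

Lemma rsumN (u : V -> R) : rsum (fun x => - u x) = - rsum u.
Proof.
rewrite /rsum.
have -> : EFin \o (fun x => - u x) = (\- (EFin \o u))%E by [].
rewrite funeposN funenegN.
by case: (\esum_(x in _) _)%E => [a| |]; case: (\esum_(x in _) _)%E => [b| |] //=;
   rewrite ?oppr0 ?opprB.
Qed.

Lemma csum_conj (u : V -> R[i]) : csum (conjf u) = (csum u)^*.
Proof.
rewrite /csum /conjf /= -rsumN; congr (_ +i* _); congr rsum; apply/funext => x;
  by case: (u x).
Qed.

Lemma inner_conj f g : inner (conjf f) (conjf g) = (inner f g)^*.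
Proof.
by rewrite /inner -csum_conj; congr csum; apply/funext => x; rewrite /conjf rmorphM.
Qed.

Definition conj_invariant T := forall f g, T (f, g) -> T (conjf f, conjf g).

Lemma conj_invariant_closure T : conj_invariant T -> conj_invariant (op_closure T).
Proof.
move=> cT f g [/= lf lg H]; split => /=; [exact: l2_conj|exact: l2_conj|].
move=> e /H [[f' g'] /= Tq [H1 H2]]; exists (conjf f', conjf g'); first exact: cT.
by rewrite /= !sqnorm_conjB.
Qed.

Lemma conj_invariant_adjoint T : conj_invariant T -> conj_invariant (op_adjoint T).
Proof.
move=> cT f g [/= lf lg H]; split => /=; [exact: l2_conj|exact: l2_conj|].
move=> [f' g'] /= /cT /H /= E.
by rewrite -[f']conjfK -[g']conjfK !inner_conj E.
Qed.

Lemma op_ker_conj T z f : conj_invariant T -> op_ker T z f ->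
  op_ker T z^* (conjf f).
Proof.
move=> cT /cT; rewrite /op_ker /=; congr T; congr pair.
by apply/funext => x; rewrite /conjf rmorphM.
Qed.

Lemma lin_indep_conj n (v : 'I_n -> V -> R[i]) : lin_indep v ->
  lin_indep (fun i => conjf (v i)).
Proof.
move=> indep c H i.
suff : (c i)^* = 0 by move/eqP; rewrite conjc_eq0 => /eqP.
apply: (indep (fun i => (c i)^*)) => x.
transitivity ((\sum_(j < n) c j * conjf (v j) x)^*).
  by rewrite rmorph_sum; apply: eq_bigr => j _; rewrite rmorphM /conjf /= conjcK.
by rewrite H conjc0.
Qed.

Lemma le_dimension_ker_conj T z : conj_invariant T ->
  (dimension (op_ker T z) <= dimension (op_ker T z^*))%E.
Proof.
move=> cT; apply: ereal_sup_le => _ [n [v [iv kv]] <-]; exists n => //.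
exists (fun i => conjf (v i)); split; first exact: lin_indep_conj.
by move=> i; exact: op_ker_conj.
Qed.

Variable G : wgraph R V.

Lemma adjacency_fun_conj f : adjacency_fun G (conjf f) = conjf (adjacency_fun G f).
Proof.
apply/funext => x; rewrite /adjacency_fun /conjf.
under eq_fsbigr do rewrite -[(G x _)%:C]conjc_real -rmorphM.
have -> : finite_support 0 (neighbors G x) (fun y => ((G x y)%:C * f y)^*)
  = finite_support 0 (neighbors G x) (fun y => (G x y)%:C * f y).
  rewrite /finite_support; suff -> : (fun y => ((G x y)%:C * f y)^*) @^-1` [set~ 0]
    = (fun y => (G x y)%:C * f y) @^-1` [set~ 0] by [].
  apply/seteqP; split => y /=; apply: contra_not; first by move=> ->; rewrite conjc0.
  by move/eqP; rewrite conjc_eq0 => /eqP.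
by rewrite [RHS]rmorph_sum.
Qed.

Lemma conj_invariant_adjacency0 : conj_invariant (adjacency0 G).
Proof.
move=> f g [/= ff ->]; split => /=; last by rewrite adjacency_fun_conj.
rewrite /finitely_supported /=; congr finite_set: ff.
by apply/seteqP; split => x /=; rewrite conjc_eq0.
Qed.

Lemma deficiency_conj z : deficiency G z^* = deficiency G z.
Proof.
have cA : conj_invariant (op_adjoint (adjacency G)).
  apply/conj_invariant_adjoint/conj_invariant_closure.
  exact: conj_invariant_adjacency0.
apply/eqP; rewrite eq_le /deficiency -{2}[z]conjcK.
by rewrite !le_dimension_ker_conj.
Qed.

Lemma eta_conj : eta G = deficiency G (- 'i).
Proof.
rewrite /eta -[in RHS]deficiency_conj; congr (deficiency G _).
by rewrite rmorphN /=; apply/eqP; rewrite eq_complex /= oppr0 opprK !eqxx.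
Qed.

End Conjugation.

(* Main.v *)
Require Import Defs.
From mathcomp Require Import all_boot all_order all_algebra.
From mathcomp Require Import finmap complex.
From mathcomp Require Import boolp classical_sets.
From mathcomp Require Import cardinality fsbigop reals ereal numfun esum exp.
From mathcomp Require Import zify ring lra.

Set Implicit Arguments.
Unset Strict Implicit.
Unset Printing Implicit Defensive.

Import Order.TTheory GRing.Theory Num.Theory.
Local Open Scope classical_set_scope.
Local Open Scope ring_scope.
Local Open Scope complex_scope.

(** A vertex x of the graph below has four kinds of neighbours: its predecessor
    and successor on the line N, a parent, and a block of children, the c with
    T x <= c < T (x+1), where T x = (x + K)^2 for a constant K.  The blocks are
    disjoint and x has 2(x + K) + 1 children, so the degree grows by 2 from one
    vertex to the next, up to bounded boundary effects.  This already gives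
    |d(n) - d(n+1)| <= 3 for n >= 1, and the factor n^(-alpha) <= 1 is harmless.

    The rest of the argument is to solve A f = i f in l2.  All neighbours of x
    other than its children lie below T x, so the equation at x only prescribes
    the sum of f over the children of x once f is known below T x.  Sharing the
    prescribed sum equally among the children determines f recursively
    ([spread], [causal_fixpoint], [eigen_adjacency]).  Adding to the equal shares
    a source d whose sum over each block vanishes keeps f a solution.  With the
    source dipole j, which is 1 and -1 on the first two children of j, the
    solution vanishes below T j and equals 1 at T j, so that these solutions are
    linearly independent.

    They are square summable because the branching grows: with w x the number of
    children of x, the block of x contributes to the squared norm at most
    (8 / w x) times the sum of |f|^2 over x and its older neighbours, plus twice
    the contribution of the source ([sum_children_nsq]).  Summing over x, a
    vertex y gets total weight O(1/K): as vertex or neighbour on the line, because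
    w x >= 2K; as a parent, because its w y children are all at least T y ~ y^2,
    so that the weights 8 / w of these children add up to O(w y / T y) = O(1/K).
    For K = 48 the total weight is at most 1/2, so the partial sums P satisfy
    P <= 2E + P/2, where E bounds the squared norm of the source
    ([eigen_sum_le]).

    Finally, a square summable pointwise solution of A f = z f lies in the kernel
    of A^* - z ([ker_adjoint_adjacency]): pairing with finitely supported
    functions is a finite double sum, which is symmetric since each vertex has
    finitely many neighbours, and the pairing is continuous in l2. *)

(** * Squared modulus *)

Section SquareModulus.
Variable R : realType.
Implicit Types z w : R[i].

Definition nsq z : R := complex.Re z ^+ 2 + complex.Im z ^+ 2.

Lemma nsq_ge0 z : 0 <= nsq z.
Proof. by rewrite addr_ge0 ?sqr_ge0. Qed.

Lemma normc_sq z : ComplexField.Normc.normc z ^+ 2 = nsq z.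
Proof. by case: z => a b; rewrite /nsq /= sqr_sqrtr ?addr_ge0 ?sqr_ge0. Qed.

Lemma nsq0 : nsq 0 = 0.
Proof. by rewrite /nsq /= expr0n addr0. Qed.

Lemma nsq1 : nsq 1 = 1.
Proof. by rewrite /nsq /= expr0n expr1n addr0. Qed.

Lemma nsqM z w : nsq (z * w) = nsq z * nsq w.
Proof. by case: z w => [a b] [c d]; rewrite /nsq /=; ring. Qed.

Lemma nsq_real (r : R) : nsq r%:C = r ^+ 2.
Proof. by rewrite /nsq /= expr0n addr0. Qed.

Lemma nsqN z : nsq (- z) = nsq z.
Proof. by case: z => a b; rewrite /nsq /= !sqrrN. Qed.

Lemma nsq_conj z : nsq z^* = nsq z.
Proof. by case: z => a b; rewrite /nsq /= sqrrN. Qed.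

Lemma nsq_i : nsq 'i = 1.
Proof. by rewrite /nsq /= expr0n expr1n add0r. Qed.

Lemma nsqD z w : nsq (z + w) <= 2 * (nsq z + nsq w).
Proof.
rewrite -subr_ge0; case: z w => [a b] [c d]; rewrite /nsq /=.
rewrite (_ : _ - _ = (a - c) ^+ 2 + (b - d) ^+ 2); last by ring.
by rewrite addr_ge0 ?sqr_ge0.
Qed.

(** The free parameter t replaces square roots in the Cauchy-Schwarz inequality:
    for |z|^2 of order t^2 and |w|^2 bounded, the right-hand side is of order
    t. *)
Lemma ReM_le_nsq (t : R) z w : 0 < t ->
  `|complex.Re (z * w)| <= t^-1 * nsq z + t * nsq w.
Proof.
move=> t0; case: z w => [a b] [c d]; rewrite /nsq /= ler_norml.
have [s ts] : exists s, t * s = 1 by exists t^-1; rewrite mulfV ?gt_eqF.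
have -> : t^-1 = s by rewrite -[LHS]mulr1 -ts mulKf ?gt_eqF.
have s0 : 0 < s by rewrite -(pmulr_rgt0 _ t0) ts.
have h x y : `|x * y| * 2 <= s * x ^+ 2 + t * y ^+ 2.
  rewrite -subr_ge0.
  have -> : s * x ^+ 2 + t * y ^+ 2 - `|x * y| * 2 = s * (`|x| - t * `|y|) ^+ 2.
    have -> : s * (`|x| - t * `|y|) ^+ 2 =
      s * `|x| ^+ 2 - (t * s) * (`|x| * `|y|) * 2 + t * (t * s) * `|y| ^+ 2 by ring.
    by rewrite ts !real_normK ?num_real// normrM; ring.
  by rewrite mulr_ge0 ?sqr_ge0 ?ltW.
have := h a c; have := h b d.
have := ler_norm (a * c); have := ler_norm (b * d).
have := ler_norm (- (a * c)); have := ler_norm (- (b * d)); rewrite !normrN.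
have := normr_ge0 (a * c); have := normr_ge0 (b * d).
by lra.
Qed.

End SquareModulus.

(** * Sums of absolutely summable families *)

Section L2.
Variables (R : realType) (V : countType).
Implicit Types (f g h : V -> R[i]) (u v : V -> R).

Lemma sqnormE f : sqnorm f = \esum_(x in setT) (nsq (f x))%:E.
Proof. by apply: eq_esum => x _; rewrite normc_sq. Qed.

Lemma sqnorm_ge0 f : (0 <= sqnorm f)%E.
Proof. by rewrite sqnormE; apply: esum_ge0 => x _; rewrite lee_fin nsq_ge0. Qed.

(** Reduces bounds on extended-real sums to bounds on real finite sums. *)
Lemma esum_leP u (B : R) :
  (\esum_(x in setT) (u x)%:E <= B%:E)%E <->
  (forall s : seq V, uniq s -> \sum_(x <- s) u x <= B).
Proof.
split=> [uB s us|H].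
  rewrite -lee_fin; apply: le_trans uB; apply: esum_ge.
  exists [set` s]; first by split=> //; exact: finite_seq.
  by rewrite -fsbig_seq// sumEFin.
apply: ge_ereal_sup => _ [X [finX _] <-].
rewrite fsbig_finite// sumEFin lee_fin; exact/H/fset_uniq.
Qed.

Definition absum_le u (B : R) :=
  forall s : seq V, uniq s -> \sum_(x <- s) `|u x| <= B.

Lemma absum_le_summable u B : absum_le u B -> summable setT (EFin \o u).
Proof. by move=> /esum_leP uB; rewrite /summable (le_lt_trans uB) ?ltry. Qed.

Lemma absum_le_rsum u B : absum_le u B -> `|rsum u| <= B.
Proof.
move=> uB; rewrite /rsum.
have hp : (0 <= \esum_(x in setT) ((EFin \o u)^\+ x) <= B%:E)%E.
  rewrite esum_ge0//=; apply: le_trans ((esum_leP _ _).2 uB).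
  apply: le_esum => x _.
  by rewrite -[(`|_|)%:E]/((abse \o (EFin \o u)) x) fune_abse /= leeDl.
have hn : (0 <= \esum_(x in setT) ((EFin \o u)^\- x) <= B%:E)%E.
  rewrite esum_ge0//=; apply: le_trans ((esum_leP _ _).2 uB).
  apply: le_esum => x _.
  by rewrite -[(`|_|)%:E]/((abse \o (EFin \o u)) x) fune_abse /= leeDr.
case: (\esum_(x in _) _)%E hp => [a| |]; rewrite ?leye_eq ?andbF//.
case: (\esum_(x in _) _)%E hn => [b| |]; rewrite ?leye_eq ?andbF//.
by rewrite !lee_fin /= => /andP[? ?] /andP[? ?]; rewrite ler_norml; lra.
Qed.

(** The positive part of u - v is not u^+ + v^-; only the differences agree, which
    is the content of [esumB]. *)
Lemma rsumB u v : summable setT (EFin \o u) -> summable setT (EFin \o v) ->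
  rsum (fun x => u x - v x) = rsum u - rsum v.
Proof.
move=> su sv; rewrite /rsum.
have sup := summable_funepos su; have sun := summable_funeneg su.
have svp := summable_funepos sv; have svn := summable_funeneg sv.
have -> : EFin \o (fun x => u x - v x) =
  (((EFin \o u)^\+ \+ (EFin \o v)^\-) \- ((EFin \o u)^\- \+ (EFin \o v)^\+))%E.
  apply/funext => x /=; rewrite !funeposE !funenegE /= -!EFin_max.
  rewrite -!(EFinD, EFinN); congr EFin.
  by case: (leP (u x) 0) => ?; case: (leP (v x) 0) => ?;
    case: (leP (- u x) 0) => ?; case: (leP (- v x) 0) => ?; lra.
rewrite esumB; first last.
- by move=> i _; rewrite adde_ge0.
- by move=> i _; rewrite adde_ge0.
- exact: summableD.
- exact: summableD.
rewrite !esumD//.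
have fin (w : V -> \bar R) : summable setT w -> (forall x, (0 <= w x)%E) ->
    \esum_(x in setT) w x \is a fin_num.
  move=> sw w0; rewrite -(eq_esum (a := abse \o w)) -?summableE//.
  by move=> x _ /=; rewrite gee0_abs.
have := fin _ sup (fun x => funepos_ge0 _ x).
have := fin _ sun (fun x => funeneg_ge0 _ x).
have := fin _ svp (fun x => funepos_ge0 _ x).
have := fin _ svn (fun x => funeneg_ge0 _ x).
do 4!case: (\esum_(x in _) _)%E => // ?.
by move=> _ _ _ _ /=; ring.
Qed.

Lemma rsum_fin u (s : seq V) : uniq s -> (forall x, x \notin s -> u x = 0) ->
  rsum u = \sum_(x <- s) u x.
Proof.
move=> us u0; rewrite /rsum.
have E (w : V -> R) : (forall x, 0 <= w x) -> (forall x, x \notin s -> w x = 0) ->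
    \esum_(x in setT) (w x)%:E = (\sum_(x <- s) w x)%:E.
  move=> w0 ws; transitivity (\esum_(x in [set` s]) (w x)%:E).
    rewrite [RHS]esum_mkcond; apply: eq_esum => x _.
    by rewrite mem_setE; case: ifPn => // /ws ->.
  by rewrite esum_fset//= -?fsbig_seq ?sumEFin// => x _; rewrite lee_fin.
have -> : \esum_(x in [set: V]) ((EFin \o u)^\+ x)%E =
          \esum_(x in setT) (Num.max (u x) 0)%:E.
  by apply: eq_esum => x _; rewrite funeposE /= EFin_max.
have -> : \esum_(x in [set: V]) ((EFin \o u)^\- x)%E =
          \esum_(x in setT) (Num.max (- u x) 0)%:E.
  by apply: eq_esum => x _; rewrite funenegE /= EFin_max.
have M a : 0 <= Num.max a (0 : R) by rewrite le_max lexx orbT.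
rewrite (E _ (fun x => M (u x))) => [|x /u0 ->]; last by rewrite maxxx.
rewrite (E _ (fun x => M (- u x))) => [|x /u0 ->]; last by rewrite oppr0 maxxx.
rewrite /= -sumrB; apply: eq_bigr => x _.
by case: (leP (u x) 0); case: (leP (- u x) 0); lra.
Qed.

Lemma csum_fin (w : V -> R[i]) (s : seq V) : uniq s ->
  (forall x, x \notin s -> w x = 0) -> csum w = \sum_(x <- s) w x.
Proof.
move=> us w0; rewrite /csum !(@rsum_fin _ s)//; try by move=> x /w0 ->.
elim: s {us w0} => [|x s IH]; first by rewrite !big_nil.
by rewrite !big_cons -IH; case: (w x).
Qed.

End L2.

(** * Pairings in l2 and the adjoint of the adjacency operator *)

Section Inner.
Variables (R : realType) (V : countType).
Implicit Types (f g h : V -> R[i]).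

Lemma sqnorm_leP f (B : R) :
  (sqnorm f <= B%:E)%E <->
  (forall s : seq V, uniq s -> \sum_(x <- s) nsq (f x) <= B).
Proof. by rewrite sqnormE; exact: esum_leP. Qed.

Lemma l2P f : l2 f <-> exists B : R, (sqnorm f <= B%:E)%E.
Proof.
rewrite /l2 /=; split=> [fl|[B /le_lt_trans]]; last by apply; rewrite ltry.
exists (fine (sqnorm f)); rewrite fineK// ge0_fin_numE//.
exact: sqnorm_ge0.
Qed.

Lemma absum_le_Re f g (t A B : R) : 0 < t ->
  (sqnorm f <= A%:E)%E -> (sqnorm g <= B%:E)%E ->
  absum_le (fun x => complex.Re (f x * (g x)^*)) (t^-1 * A + t * B).
Proof.
move=> t0 /sqnorm_leP fA /sqnorm_leP gB s us.
apply: (@le_trans _ _ (\sum_(x <- s) (t^-1 * nsq (f x) + t * nsq (g x)))).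
  by apply: ler_sum => x _; rewrite -(nsq_conj (g x)); exact: ReM_le_nsq.
rewrite big_split/= -!mulr_sumr.
by rewrite lerD// ler_wpM2l ?invr_ge0 ?(ltW t0) ?fA ?gB.
Qed.

(** The imaginary part of u is the real part of -i u. *)
Lemma absum_le_Im f g (t A B : R) : 0 < t ->
  (sqnorm f <= A%:E)%E -> (sqnorm g <= B%:E)%E ->
  absum_le (fun x => complex.Im (f x * (g x)^*)) (t^-1 * A + t * B).
Proof.
move=> t0 fA gB.
have -> : (fun x => complex.Im (f x * (g x)^*)) =
          (fun x => complex.Re ((- 'i * f x) * (g x)^*)).
  by apply/funext => x; case: (f x) (g x) => [a b] [c d] /=; ring.
apply: absum_le_Re => //; rewrite !sqnormE in fA *.
apply: le_trans fA; apply: le_esum => x _.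
by rewrite nsqM nsqN nsq_i mul1r.
Qed.

Lemma inner_small f g (t N : R) : 0 < t ->
  (sqnorm f <= (t ^+ 2)%:E)%E -> (sqnorm g <= N%:E)%E ->
  `|complex.Re (inner f g)| <= t * (1 + N) /\
  `|complex.Im (inner f g)| <= t * (1 + N).
Proof.
move=> t0 ft gN; have -> : t * (1 + N) = t^-1 * t ^+ 2 + t * N.
  by rewrite expr2 mulKf ?gt_eqF// mulrDr mulr1.
by split; apply: absum_le_rsum; [exact: absum_le_Re|exact: absum_le_Im].
Qed.

Lemma innerBl f h g : l2 f -> l2 h -> l2 g ->
  inner (fun x => f x - h x) g = inner f g - inner h g.
Proof.
move=> /l2P[A fA] /l2P[B hB] /l2P[N gN].
have ReB (a b : R[i]) : complex.Re (a - b) = complex.Re a - complex.Re b.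
  by case: a b => [??] [].
have ImB (a b : R[i]) : complex.Im (a - b) = complex.Im a - complex.Im b.
  by case: a b => [??] [].
rewrite /inner /csum.
under [in LHS]eq_fun do rewrite mulrBl ReB.
under [X in _ +i* rsum X]eq_fun do rewrite mulrBl ImB.
rewrite !rsumB//; apply: absum_le_summable.
- exact: (absum_le_Im ltr01 fA gN).
- exact: (absum_le_Im ltr01 hB gN).
- exact: (absum_le_Re ltr01 fA gN).
- exact: (absum_le_Re ltr01 hB gN).
Qed.

Lemma inner_approx f h g : l2 f -> l2 (fun x => f x - h x) -> l2 g ->
  inner h g = inner f g - inner (fun x => f x - h x) g.
Proof.
move=> lf lfh lg; rewrite -innerBl//.
suff -> : (fun x => f x - (f x - h x)) = h by [].
by apply/funext => x; rewrite subKr.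
Qed.

Lemma inner_fin f g (s : seq V) : uniq s -> (forall x, x \notin s -> f x = 0) ->
  inner f g = \sum_(x <- s) f x * (g x)^*.
Proof. by move=> us f0; apply: csum_fin => // x /f0 ->; rewrite mul0r. Qed.

Variable G : wgraph R V.

Lemma adjacency_fun_sum f x (s : seq V) : uniq s ->
  (forall y, adjacent G x y -> f y != 0 -> y \in s) ->
  adjacency_fun G f x = \sum_(y <- s) (G x y)%:C * f y.
Proof.
move=> us H; rewrite /adjacency_fun.
have E y : y \notin neighbors G x -> (G x y)%:C * f y = 0.
  rewrite notin_setE /neighbors /= /adjacent => /negP; rewrite negbK => /eqP ->.
  by rewrite mul0r.
rewrite (fsbig_widen _ setT)//=; last first.
  by move=> y [_ /=] ?; apply: E; rewrite notin_setE.
rewrite (fsbigE s)//=; first by under eq_bigl do rewrite in_setT.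
move=> y _ ys; apply/eqP/negP => /negP; rewrite mulf_eq0 negb_or => /andP[Gxy fy].
have xy : adjacent G x y by apply: contra_neq Gxy => ->.
by rewrite (H y xy fy) in ys.
Qed.

Hypothesis lf : graph_locally_finite G.

(** All sums can be restricted to one finite set S that contains the support of g
    and its neighbours. *)
Lemma adjacency0_symmetric f g : finitely_supported g ->
  inner (adjacency_fun G g) f = inner g (adjacency_fun G f).
Proof.
move=> /finite_seqP[s0 gs0].
have [nb nbE] := choice (fun x => (finite_seqP _).1 (lf x)).
pose S := undup (s0 ++ flatten [seq nb x | x <- s0]).
have uS : uniq S by exact: undup_uniq.
have g0 x : g x != 0 -> x \in s0.
  by move=> gx; have : [set` s0] x by rewrite -gs0.
have sS x : x \in s0 -> x \in S by move=> xs; rewrite mem_undup mem_cat xs.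
have nS x y : x \in s0 -> adjacent G x y -> y \in S.
  move=> xs xy; rewrite mem_undup mem_cat; apply/orP; right.
  apply/flattenP; exists (nb x); first exact: map_f.
  by have : neighbors G x y by []; rewrite nbE.
have Ag x : adjacency_fun G g x = \sum_(y <- S) (G x y)%:C * g y.
  by apply: adjacency_fun_sum => // y _ /g0; exact: sS.
have Af y : y \in s0 -> adjacency_fun G f y = \sum_(x <- S) (G y x)%:C * f x.
  by move=> ys; apply: adjacency_fun_sum => // x xy _; exact: nS xy.
rewrite (inner_fin _ uS); last first.
  move=> x xS; rewrite Ag big1_seq// => y /= yS.
  have [->|/g0 ys] := eqVneq (g y) 0; first by rewrite mulr0.
  have [->|xy] := eqVneq (G x y) 0; first by rewrite mul0r.
  by rewrite (nS y x) in xS => //; rewrite /adjacent weight_sym.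
rewrite (inner_fin _ uS); last first.
  by move=> x; apply: contraNeq => /g0; exact: sS.
under eq_bigr do rewrite Ag mulr_suml.
rewrite exchange_big/=; apply: eq_bigr => y _.
have [->|/g0 ys] := eqVneq (g y) 0.
  by rewrite mul0r big1// => x _; rewrite mulr0 mul0r.
rewrite Af// rmorph_sum mulr_sumr; apply: eq_bigr => x _.
rewrite [X in _ = _ * X](_ : _ = (G y x)%:C * (f x)^*); last first.
  by rewrite -[in RHS](conjc_real (G y x)) -[RHS]rmorphM.
by rewrite weight_sym [in RHS]mulrCA mulrA.
Qed.

(** For (g, h) in the closure, approximate it within t by (g', A g').  The two
    pairings agree on the approximation, so the discrepancy D between those of
    (g, h) is O(t) for every t > 0. *)
Lemma ker_adjoint_adjacency f (z : R[i]) : l2 f -> l2 (fun x => z * f x) ->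
  (forall x, adjacency_fun G f x = z * f x) ->
  op_ker (op_adjoint (adjacency G)) z f.
Proof.
move=> lf2 lzf fz; split => //= -[g h] /= [/= lg lh cl].
have /l2P[N fN] := lf2; have /l2P[N' zN] := lzf.
have zfE : (fun x => z * f x) = adjacency_fun G f by apply/funext => x; rewrite fz.
have N0 : 0 <= N by rewrite -lee_fin (le_trans _ fN)// sqnorm_ge0.
have N'0 : 0 <= N' by rewrite -lee_fin (le_trans _ zN)// sqnorm_ge0.
have [D DE] : exists D : R[i], D = inner h f - inner g (fun x => z * f x).
  by eexists.
have key (t : R) : 0 < t ->
   `|complex.Re D| <= t * (2 + N + N') /\ `|complex.Im D| <= t * (2 + N + N').
  move=> t0; have t20 : 0 < t ^+ 2 by rewrite exprn_gt0.
  have [[g' h'] [/= fg' h'E] [/= gg' hh']] := cl _ t20.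
  rewrite {}h'E in hh'.
  have l2' (u v : V -> R[i]) : (sqnorm (fun x => (u x - v x)%R) < (t ^+ 2)%:E)%E ->
      l2 (fun x => u x - v x).
    by move=> /lt_trans; apply; rewrite ltry.
  set A' := adjacency_fun G g' in hh' |- *.
  have E1 : inner A' f = inner h f - inner (fun x => h x - A' x) f.
    by apply: inner_approx => //; exact: l2'.
  have E2 : inner g' (fun x => z * f x) = inner g (fun x => z * f x)
      - inner (fun x => g x - g' x) (fun x => z * f x).
    by apply: inner_approx => //; exact: l2'.
  have E : inner A' f = inner g' (fun x => z * f x).
    by rewrite zfE; exact: adjacency0_symmetric.
  have [r1 i1] := inner_small t0 (ltW hh') fN.
  have [r2 i2] := inner_small t0 (ltW gg') zN.
  have -> : D =
     inner (fun x => h x - A' x) f - inner (fun x => g x - g' x) (fun x => z * f x).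
    rewrite DE; move: E; rewrite E1 E2 => /eqP; rewrite subr_eq => /eqP ->.
    by rewrite addrC addrA addrA addNr add0r addrC.
  move: r1 i1 r2 i2; case: (inner _ f) => a b; case: (inner _ _) => c d /=.
  rewrite !ler_norml => /andP[? ?] /andP[? ?] /andP[? ?] /andP[? ?].
  by split; apply/andP; split; lra.
have small (a : R) : (forall t, 0 < t -> `|a| <= t * (2 + N + N')) -> a = 0.
  move=> H; apply/eqP; rewrite -normr_le0; apply/ler_addgt0Pl => e e0.
  have P0 : 0 < 2 + N + N' by lra.
  by have := H (e / (2 + N + N')); rewrite divr_gt0// divfK ?gt_eqF// addr0; apply.
apply/eqP; rewrite -subr_eq0 -DE eq_complex.
by apply/andP; split; apply/eqP; apply: small => t /key[].
Qed.

End Inner.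

(** * Infinite dimension from a triangular family *)

Section InfiniteDimension.
Variables (R : realType) (V : countType).

Lemma dimension_infinite (K : set (V -> R[i])) (v : nat -> V -> R[i]) (e : nat -> V) :
  (forall j, K (v j)) -> (forall j, v j (e j) != 0) ->
  (forall j k, (j < k)%N -> v k (e j) = 0) ->
  dimension K = +oo%E.
Proof.
move=> Kv vd vt; apply: eq_infty => r.
pose n := (Num.truncn `|r|).+1.
apply: (@le_trans _ _ n%:R%:E).
  by rewrite lee_fin (le_trans (ler_norm r))// ltW// truncnS_gt.
apply: ereal_sup_ubound; exists n => //; exists (fun i => v i); split => // c c0.
suff H m (i : 'I_n) : (i < m)%N -> c i = 0 by move=> i; exact: (H i.+1).
elim: m i => // m IH i im; have := c0 (e i).
rewrite (bigD1 i)//= big1 ?addr0 => [/eqP|j ji].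
  by rewrite mulf_eq0 (negPf (vd _)) orbF => /eqP.
have [ij|] := ltnP i j; first by rewrite vt ?mulr0.
rewrite leq_eqVlt => /orP[/eqP/val_inj jiE|ij]; first by rewrite jiE eqxx in ji.
by rewrite IH ?mul0r// (leq_trans ij).
Qed.

End InfiniteDimension.

(** * Course-of-values recursion and finite sums *)

(** The iterates of Phi converge pointwise: the n-th value is stable after n + 1
    iterations. *)
Lemma causal_fixpoint (A : Type) (Phi : (nat -> A) -> nat -> A) : inhabited A ->
  (forall f g n, (forall m, (m < n)%N -> f m = g m) -> Phi f n = Phi g n) ->
  exists f, forall n, f n = Phi f n.
Proof.
move=> [a0] PhiE; pose it k := iter k Phi (fun=> a0).
have itE n k : (n < k)%N -> it k n = it n.+1 n.
  elim/ltn_ind: n k => n IH [//|k] nk; apply: PhiE => m mn.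
  transitivity (it m.+1 m); last exact/esym/IH.
  by apply: IH => //; exact: leq_trans mn nk.
exists (fun n => it n.+1 n) => n; apply: PhiE => m mn.
exact: itE.
Qed.

Lemma sum_pred1 (S : pzSemiRingType) (T : eqType) (s : seq T) (a : T) : uniq s ->
  \sum_(c <- s) (c == a)%:R = (a \in s)%:R :> S.
Proof.
move=> us; rewrite -count_uniq_mem// -sum1_count natr_sum [RHS]big_mkcond/=.
by apply: eq_bigr => c _; case: (c == a).
Qed.

Lemma sum_nat_mono (R : numDomainType) (F : nat -> R) m n :
  (forall c, 0 <= F c) -> (m <= n)%N ->
  \sum_(0 <= c < m) F c <= \sum_(0 <= c < n) F c.
Proof.
move=> F0 mn; rewrite [leRHS](big_cat_nat (n := m))//= lerDl.
by apply: sumr_ge0.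
Qed.

(** * The graph *)

Section Combinatorics.
Variable K : nat.

Definition first_child x := ((x + K) ^ 2)%N.
Local Notation T := first_child.
Definition width x := (2 * (x + K) + 1)%N.
Definition children x := iota (T x) (width x).

Lemma first_childS x : T x.+1 = (T x + width x)%N.
Proof. by rewrite /first_child /width; lia. Qed.

Lemma width_gt0 x : (0 < width x)%N.
Proof. by rewrite /width addn1. Qed.

Lemma mem_children x c : (c \in children x) = (T x <= c < T x.+1)%N.
Proof. by rewrite mem_iota first_childS. Qed.

Lemma leq_first_child x y : (T x <= T y)%N = (x <= y)%N.
Proof. by rewrite leq_exp2r// leq_add2r. Qed.

Lemma children_ge x c : c \in children x -> (T 0 <= c)%N.
Proof.
by rewrite mem_children => /andP[+ _]; apply: leq_trans; rewrite leq_first_child.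
Qed.

Lemma ltn_first_child x y : (T x < T y)%N = (x < y)%N.
Proof. by rewrite ltn_exp2r// ltn_add2r. Qed.

Hypothesis K_gt1 : (1 < K)%N.

(** The children of x come after its neighbours on the line, so no edge of the
    line joins a parent to a child. *)
Lemma ltSn_first_child x : (x.+1 < T x)%N.
Proof. by rewrite /first_child; nia. Qed.

Lemma ltn_first_child_self x : (x < T x)%N.
Proof. exact: ltnW (ltSn_first_child x). Qed.

Lemma children_inj x y c : c \in children x -> c \in children y -> x = y.
Proof.
rewrite !mem_children => /andP[xc cx] /andP[yc cy].
have := leq_ltn_trans xc cy; have := leq_ltn_trans yc cx.
by rewrite !ltn_first_child; lia.
Qed.

Lemma exists_parent c : exists x, (c < T x.+1)%N.
Proof. by exists c; exact/ltnW/ltnW/ltSn_first_child. Qed.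

(** Below T 0 there is no parent and the value is a default; [parents] guards
    against it. *)
Definition parent c := ex_minn (exists_parent c).

Lemma mem_children_parent c : (T 0 <= c)%N -> c \in children (parent c).
Proof.
rewrite mem_children /parent => c0; case: ex_minnP => x -> xmin; rewrite andbT.
by case: x xmin => // x xmin; rewrite leqNgt; apply/negP => /xmin; rewrite ltnn.
Qed.

Lemma parentE x c : c \in children x -> parent c = x.
Proof.
move=> cx; apply: children_inj (cx); apply: mem_children_parent.
exact: children_ge cx.
Qed.

Definition preds x := if x is y.+1 then [:: y] else [::].
Definition parents x := if (T 0 <= x)%N then [:: parent x] else [::].

(** The neighbours of x are split as older x ++ children x: the equation at x is
    solved for the children, all older neighbours being known by then. *)
Definition older x := preds x ++ x.+1 :: parents x.
Definition nbrs x := older x ++ children x.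

Lemma mem_preds x y : (y \in preds x) = (x == y.+1).
Proof. by case: x => // x; rewrite /= inE eqSS eq_sym. Qed.

Lemma mem_parents x y : (y \in parents x) = (x \in children y).
Proof.
rewrite /parents; case: ifPn => x0.
  rewrite inE; apply/eqP/idP => [->|/parentE//]; exact: mem_children_parent.
by rewrite in_nil; apply/esym/negbTE; apply: contra x0; exact: children_ge.
Qed.

Lemma mem_nbrs x y : (y \in nbrs x) =
  [|| x == y.+1, y == x.+1, x \in children y | y \in children x].
Proof. by rewrite /nbrs /older !mem_cat inE mem_preds mem_parents -!orbA. Qed.

Lemma nbrs_sym x y : (y \in nbrs x) = (x \in nbrs y).
Proof. by rewrite !mem_nbrs orbCA; do 2!congr orb; rewrite orbC. Qed.

Lemma nbrs_irrefl x : x \notin nbrs x.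
Proof.
rewrite mem_nbrs !mem_children orbb !negb_or leqNgt ltn_first_child_self/=.
by rewrite !neq_ltn ltnSn.
Qed.

(** This makes the recursion well founded: the equation at x is solved for
    its children, and it involves no other vertex from T x on. *)
Lemma older_lt x y : y \in older x -> (y < T x)%N.
Proof.
rewrite /older mem_cat inE mem_preds mem_parents => /or3P[/eqP->|/eqP->|].
- by apply: ltn_trans (ltn_first_child_self _).
- exact: ltSn_first_child.
- rewrite mem_children => /andP[yx _].
  apply: leq_trans (ltn_first_child_self y) _.
  by apply: leq_trans yx (ltnW (ltn_first_child_self x)).
Qed.

Lemma uniq_nbrs x : uniq (nbrs x).
Proof.
rewrite cat_uniq iota_uniq andbT; apply/andP; split; last first.
  apply/hasPn => y; rewrite mem_children => /andP[xy _].
  by apply/negP => /older_lt; rewrite ltnNge xy.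
have up : uniq (parents x) by rewrite /parents; case: ifP.
have parents_lt y : y \in parents x -> (y.+1 < x)%N.
  rewrite mem_parents mem_children => /andP[+ _].
  exact: leq_trans (ltSn_first_child y).
rewrite /older cat_uniq /= up andbT.
have -> /= : uniq (preds x) by case: (x).
apply/andP; split; last by apply/negP => /parents_lt/ltnW/ltnW; rewrite ltnn.
rewrite negb_or mem_preds; apply/andP; split; first by lia.
by apply/hasPn => y /parents_lt yx; rewrite /= mem_preds; lia.
Qed.

Lemma size_nbrs x : size (nbrs x) = ((0 < x) + 1 + (T 0 <= x) + width x)%N.
Proof.
by rewrite !size_cat /= size_iota /parents addnS addn1; case: x => [|x]; case: ifP.
Qed.

Lemma sum_first_child (S : nmodType) (F : nat -> S) X :
  \sum_(0 <= c < T X) F c =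
    \sum_(0 <= c < T 0) F c + \sum_(0 <= x < X) \sum_(c <- children x) F c.
Proof.
elim: X => [|X IH]; first by rewrite [X in _ = _ + X]big_geq ?addr0.
rewrite [X in _ = _ + X]big_nat_recr//= addrA -IH.
rewrite (big_cat_nat (n := T X))//=; last by rewrite leq_first_child.
by congr (_ + _); rewrite /index_iota first_childS addKn.
Qed.

Section TheGraph.
Variable R : realType.

Definition adj_weight x y : R := (y \in nbrs x)%:R.

Definition path_forest : wgraph R nat.
Proof.
apply: (@WGraph R nat adj_weight).
- by move=> x y; rewrite /adj_weight ler0n.
- by move=> x y; rewrite /adj_weight nbrs_sym.
- by move=> x; rewrite /adj_weight (negPf (nbrs_irrefl x)).
Defined.
Local Notation G := path_forest.

Lemma adjacentE x y : adjacent G x y = (y \in nbrs x).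
Proof.
by rewrite /adjacent /= /adj_weight; case: (_ \in _); rewrite ?oner_eq0 ?eqxx.
Qed.

Lemma adjacentS x : adjacent G x x.+1.
Proof. by rewrite adjacentE mem_nbrs eqxx orbT. Qed.

Lemma path_forest_simple : graph_simple G.
Proof. by move=> x y /=; rewrite /adj_weight; case: (_ \in _); [right|left]. Qed.

Lemma neighborsE x : neighbors G x = [set` nbrs x].
Proof. by apply/seteqP; split=> y; rewrite /neighbors /= adjacentE. Qed.

Lemma path_forest_locally_finite : graph_locally_finite G.
Proof. by move=> x; rewrite neighborsE; exact: finite_seq. Qed.

Lemma degreeE x : degree G x = ((0 < x) + 1 + (T 0 <= x) + width x)%N.
Proof.
rewrite -size_nbrs /degree neighborsE; apply: perm_size.
apply: uniq_perm => [||y]; [exact: fset_uniq|exact: uniq_nbrs|].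
by rewrite in_fset_set ?mem_setE//; exact: finite_seq.
Qed.

Lemma degree_step x : (0 < x)%N ->
  `|(degree G x)%:R - (degree G x.+1)%:R : R| <= 3.
Proof.
move=> x0; have : (degree G x <= degree G x.+1 <= degree G x + 3)%N.
  rewrite !degreeE /width x0 /=.
  by case: (leqP (T 0) x) => [/leqW->|_]; [|case: (T 0 <= x.+1)%N]; lia.
rewrite distrC => /andP[d1 d2]; rewrite ger0_norm ?subr_ge0 ?ler_nat//.
by rewrite lerBlDl -natrD ler_nat.
Qed.

Lemma path_forest_connected : graph_connected G.
Proof.
pose conn x y := exists s, path (adjacent G) x s /\ last x s = y.
have trans x y z : conn x y -> conn y z -> conn x z.
  move=> [s [ps <-]] [t [pt <-]]; exists (s ++ t).
  by rewrite cat_path ps pt last_cat.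
have step x y : adjacent G x y -> conn x y.
  by move=> xy; exists [:: y]; rewrite /= xy.
have up n : conn 0 n.
  by elim: n => [|n IH]; [exists [::]|apply: trans IH (step _ _ (adjacentS n))].
have down n : conn n 0.
  elim: n => [|n IH]; first by exists [::].
  by apply: trans IH; apply: step; rewrite adjacentE nbrs_sym -adjacentE adjacentS.
by move=> x y; apply: trans (down x) (up y).
Qed.

(** * Recursive solution of the eigenvalue equation *)

(** The value at c is the source plus an equal share of the sum that the equation
    at the parent of c prescribes over its children.  The vertices below T 0 have
    no parent and carry the source alone. *)
Definition spread (d f : nat -> R[i]) (c : nat) : R[i] :=
  d c + (if (c < T 0)%N then 0 else
    ((width (parent c))%:R^-1)%:C *
      ('i * f (parent c) - \sum_(y <- older (parent c)) f y)).

Lemma spread_causal d f g n :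
  (forall m, (m < n)%N -> f m = g m) -> spread d f n = spread d g n.
Proof.
move=> fg; rewrite /spread; case: ltnP => // n0; congr (_ + _ * _).
have := mem_children_parent n0; rewrite mem_children => /andP[pn _].
rewrite fg; last exact: leq_trans (ltn_first_child_self _) pn.
congr (_ - _); rewrite !big_seq; apply: eq_bigr => y /older_lt yp.
by rewrite fg// (leq_trans yp).
Qed.

Section Eigenfunction.
Variables (d f : nat -> R[i]).
Hypothesis fE : forall c, f c = spread d f c.
Hypothesis d_sum : forall x, \sum_(c <- children x) d c = 0.

Lemma eigen_child x c : c \in children x ->
  f c = d c + ((width x)%:R^-1)%:C * ('i * f x - \sum_(y <- older x) f y).
Proof.
by move=> cx; rewrite fE /spread (parentE cx) ltnNge (children_ge cx).
Qed.

Lemma eigen_root c : (c < T 0)%N -> f c = d c.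
Proof. by move=> c0; rewrite fE /spread c0 addr0. Qed.

Lemma eigen_adjacency x : adjacency_fun G f x = 'i * f x.
Proof.
rewrite (adjacency_fun_sum (uniq_nbrs x)); last by move=> y; rewrite adjacentE.
transitivity (\sum_(y <- nbrs x) f y).
  rewrite big_seq [RHS]big_seq; apply: eq_bigr => y yx.
  by rewrite /= /adj_weight yx mul1r.
rewrite /nbrs big_cat/= [X in _ + X]big_seq.
under [X in _ + X]eq_bigr => c cx do rewrite (eigen_child cx).
rewrite -big_seq big_split/= d_sum add0r.
rewrite big_const_seq count_predT size_iota iter_addr_0.
rewrite -[X in _ + X]mulr_natl mulrA -(rmorph_nat (real_complex R)) -rmorphM.
by rewrite mulfV ?pnatr_eq0 -?lt0n ?width_gt0// [X in _ + X]mul1r addrC subrK.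
Qed.

(** A solution starts where its source starts. *)
Lemma eigen_vanish j : (forall c, (c < T j)%N -> d c = 0) ->
  forall c, (c < T j)%N -> f c = 0.
Proof.
move=> d0; elim/ltn_ind => c IH cj; rewrite fE /spread d0// add0r.
case: ltnP => // c0; have := mem_children_parent c0.
rewrite mem_children => /andP[pc _].
rewrite IH ?mulr0 ?sub0r; last 2 first.
- exact: leq_trans (ltn_first_child_self _) pc.
- apply: ltn_trans cj; exact: leq_trans (ltn_first_child_self _) pc.
rewrite big_seq big1 ?oppr0 ?mulr0// => y /older_lt yp.
have yc := leq_trans yp pc.
by rewrite IH// (ltn_trans yc).
Qed.

Lemma eigen_first j : (forall c, (c < T j)%N -> d c = 0) -> f (T j) = d (T j).
Proof.
move=> d0; have v := eigen_vanish d0.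
rewrite (@eigen_child j); last by rewrite mem_children leqnn ltn_first_child /=.
rewrite v ?ltn_first_child_self// mulr0 sub0r big_seq big1 ?oppr0 ?mulr0 ?addr0//.
by move=> y /older_lt; exact: v.
Qed.

(** * Square summability of the solutions *)

Local Notation g := (fun c => nsq (f c)).

(** At most four terms, whence the factor 4. *)
Lemma nsq_eigen_rhs x : nsq ('i * f x - \sum_(y <- older x) f y) <=
  4 * (g x + \sum_(y <- preds x) g y + g x.+1 + \sum_(y <- parents x) g y).
Proof.
have -> : \sum_(y <- preds x) g y = nsq (\sum_(y <- preds x) f y).
  by case: (x) => [|y]; rewrite /= ?big_seq1// !big_nil nsq0.
have -> : \sum_(y <- parents x) g y = nsq (\sum_(y <- parents x) f y).
  by rewrite /parents; case: ifP; rewrite ?big_seq1// !big_nil nsq0.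
rewrite /older big_cat/= big_cons.
set p := \sum_(y <- preds x) f y; set q := \sum_(y <- parents x) f y.
have -> : 'i * f x - (p + (f x.+1 + q)) = ('i * f x - p) + - (f x.+1 + q).
  by rewrite opprD addrA.
have := nsqD ('i * f x - p) (- (f x.+1 + q)).
have := nsqD ('i * f x) (- p); have := nsqD (f x.+1) q.
by rewrite !nsqN nsqM nsq_i mul1r; lra.
Qed.

(** The w children of x each receive 1/w of the prescribed sum, so together they
    carry 1/w of its squared modulus.  The constant is 8 = 2 * 4, with 2 from
    separating the source and 4 from [nsq_eigen_rhs]. *)
Lemma sum_children_nsq x : \sum_(c <- children x) g c <=
  2 * \sum_(c <- children x) nsq (d c) + 8 / (width x)%:R *
    (g x + \sum_(y <- preds x) g y + g x.+1 + \sum_(y <- parents x) g y).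
Proof.
set S := _ + _ + _ + _; set w : R := (width x)%:R.
have w0 : 0 < w by rewrite ltr0n width_gt0.
have -> : 8 / w * S = \sum_(c <- children x) 8 / w ^+ 2 * S.
  rewrite big_const_seq count_predT size_iota iter_addr_0 -mulr_natl -/w.
  by field; rewrite gt_eqF.
rewrite mulr_sumr -big_split/= big_seq [leRHS]big_seq; apply: ler_sum => c cx.
rewrite (eigen_child cx); apply: le_trans (nsqD _ _) _.
rewrite mulrDr lerD2l nsqM nsq_real -/w exprVn.
have -> : 8 / w ^+ 2 * S = 2 * (w ^- 2 * (4 * S)) by ring.
by rewrite ler_pM2l// ler_pM2l ?invr_gt0 ?exprn_gt0// nsq_eigen_rhs.
Qed.

Lemma coef_ge0 x : 0 <= 8 / (width x)%:R :> R.
Proof. by rewrite divr_ge0 ?ler0n. Qed.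

Lemma coef_le x : 8 / (width x)%:R <= 4 / K%:R :> R.
Proof.
have K0 : 0 < K%:R :> R by rewrite ltr0n; lia.
rewrite ler_pdivrMr ?ltr0n ?width_gt0// mulrAC ler_pdivlMr//.
by rewrite -!natrM ler_nat /width; lia.
Qed.

(** With m = x + K, there are 2m + 1 <= 3m children c, each with more than 2m^2
    children, so the sum is at most 3m * 4/m^2 = 12/m. *)
Lemma coef_children x : \sum_(c <- children x) 8 / (width c)%:R <= 12 / K%:R :> R.
Proof.
have m0 : (0 < x + K)%N by lia.
have K0 : 0 < K%:R :> R by rewrite ltr0n; lia.
apply: (@le_trans _ _ (\sum_(c <- children x) 4 / ((x + K) ^ 2)%N%:R)).
  rewrite big_seq [leRHS]big_seq; apply: ler_sum => c.
  rewrite mem_children => /andP[xc _].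
  rewrite ler_pdivrMr ?ltr0n ?width_gt0// mulrAC ler_pdivlMr; last first.
    by rewrite ltr0n expn_gt0 m0.
  by rewrite -!natrM ler_nat /width; move: xc; rewrite /first_child; lia.
rewrite big_const_seq count_predT size_iota iter_addr_0 -[leLHS]mulr_natl mulrA.
rewrite ler_pdivrMr ?ltr0n ?expn_gt0 ?m0// mulrAC ler_pdivlMr//.
by rewrite -!natrM ler_nat /width; nia.
Qed.

Hypothesis K_ge48 : (48 <= K)%N.
Variable E : R.
Hypothesis d_le : forall N, \sum_(0 <= c < N) nsq (d c) <= E.

(** The four bounds 4/K, 4/K, 4/K and 12/K add up to 24/K <= 1/2, and the
    finite partial sum P can be absorbed into the left-hand side. *)
Lemma eigen_sum_le X : \sum_(0 <= c < T X) g c <= 4 * E.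
Proof.
set P := \sum_(0 <= c < T X) g c.
have g0 c : 0 <= g c by exact: nsq_ge0.
have K0 : 0 < K%:R :> R by rewrite ltr0n; lia.
have P_ge m : (m <= T X)%N -> \sum_(0 <= c < m) g c <= P.
  exact: sum_nat_mono.
pose k x : R := 8 / (width x)%:R.
have k0 x : 0 <= k x by exact: coef_ge0.
have kK x : k x <= 4 / K%:R by exact: coef_le.
have self : \sum_(0 <= x < X) k x * g x <= 4 / K%:R * P.
  apply: (@le_trans _ _ (\sum_(0 <= x < X) 4 / K%:R * g x)).
    by apply: ler_sum => x _; rewrite ler_wpM2r.
  rewrite -mulr_sumr ler_wpM2l ?divr_ge0 ?ler0n// P_ge//.
  exact/ltnW/ltn_first_child_self.
have pred : \sum_(0 <= x < X) k x * \sum_(y <- preds x) g y <= 4 / K%:R * P.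
  apply: (@le_trans _ _ (\sum_(0 <= x < X) 4 / K%:R * \sum_(y <- preds x) g y)).
    by apply: ler_sum => x _; rewrite ler_wpM2r ?sumr_ge0.
  rewrite -mulr_sumr ler_wpM2l ?divr_ge0 ?ler0n//.
  case: X @P P_ge {self} => [|X] P P_ge.
    by rewrite big_geq// sumr_ge0.
  rewrite big_nat_recl//= big_nil add0r.
  under eq_bigr do rewrite big_seq1.
  apply: P_ge; apply: leq_trans (ltnW (ltn_first_child_self _)) _.
  by rewrite leq_first_child.
have succ : \sum_(0 <= x < X) k x * g x.+1 <= 4 / K%:R * P.
  apply: (@le_trans _ _ (\sum_(0 <= x < X) 4 / K%:R * g x.+1)).
    by apply: ler_sum => x _; rewrite ler_wpM2r.
  rewrite -mulr_sumr ler_wpM2l ?divr_ge0 ?ler0n//.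
  apply: le_trans (P_ge X.+1 (ltn_first_child_self _)).
  by rewrite [leRHS]big_nat_recl//= lerDr.
have par : \sum_(0 <= x < X) k x * \sum_(y <- parents x) g y <= 12 / K%:R * P.
  (* The range is enlarged from X to T X to sum over complete blocks. *)
  apply: (@le_trans _ _ (\sum_(0 <= x < T X) k x * \sum_(y <- parents x) g y)).
    apply: sum_nat_mono; last exact/ltnW/ltn_first_child_self.
    by move=> x; rewrite mulr_ge0 ?sumr_ge0.
  rewrite sum_first_child big_nat big1 ?add0r; last first.
    by move=> x /andP[_ x0]; rewrite /parents leqNgt x0 /= big_nil mulr0.
  apply: (@le_trans _ _ (\sum_(0 <= x < X) 12 / K%:R * g x)); last first.
    rewrite -mulr_sumr ler_wpM2l ?divr_ge0 ?ler0n// P_ge//.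
    exact/ltnW/ltn_first_child_self.
  apply: ler_sum => x _.
  have -> : \sum_(c <- children x) k c * \sum_(y <- parents c) g y =
            (\sum_(c <- children x) k c) * g x.
    rewrite mulr_suml big_seq [RHS]big_seq; apply: eq_bigr => c cx.
    by rewrite /parents (parentE cx) (children_ge cx) big_seq1.
  by rewrite ler_wpM2r// coef_children.
have main : P <= 2 * E + (4 / K%:R * P + 4 / K%:R * P + 4 / K%:R * P + 12 / K%:R * P).
  apply: (@le_trans _ _ (2 * \sum_(0 <= c < T X) nsq (d c) +
      \sum_(0 <= x < X) k x * (g x + \sum_(y <- preds x) g y + g x.+1 +
        \sum_(y <- parents x) g y))); last first.
    apply: lerD; first by rewrite ler_wpM2l.
    under eq_bigr do rewrite 3!mulrDr.
    rewrite 3!big_split; exact: (lerD (lerD (lerD self pred) succ) par).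
  rewrite /P (sum_first_child g X) (sum_first_child (fun c => nsq (d c)) X).
  rewrite mulrDr -addrA lerD//.
    rewrite mulr_sumr big_nat [leRHS]big_nat; apply: ler_sum => c /andP[_ c0].
    by rewrite eigen_root//; have := nsq_ge0 (d c); lra.
  rewrite mulr_sumr -big_split/=; apply: ler_sum => x _.
  exact: sum_children_nsq.
have P0 : 0 <= P by apply: sumr_ge0.
have K48 : 24 / K%:R <= 2^-1 :> R.
  by rewrite ler_pdivrMr// mulrC ler_pdivlMr// -natrM ler_nat; lia.
have : 24 / K%:R * P <= 2^-1 * P by rewrite ler_wpM2r.
by move: main; lra.
Qed.

Lemma eigen_sqnorm_le : (sqnorm f <= (4 * E)%:E)%E.
Proof.
apply/sqnorm_leP => s us; pose X := (\max_(x <- s) x).+1.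
have sX x : x \in s -> x \in index_iota 0 (T X).
  move=> xs; rewrite mem_index_iota/=.
  apply: leq_ltn_trans (ltn_first_child_self X).
  by apply: leqW; rewrite (big_rem x)//= leq_maxl.
apply: le_trans (eigen_sum_le X).
have ps : perm_eq s [seq x <- index_iota 0 (T X) | x \in s].
  apply: uniq_perm; rewrite ?filter_uniq ?iota_uniq// => x.
  by rewrite mem_filter; case: (boolP (x \in s)) => // /sX ->.
rewrite (perm_big _ ps) big_filter big_mkcond/=; apply: ler_sum => x _.
by case: ifP => // _; exact: nsq_ge0.
Qed.

End Eigenfunction.

(** * Independent solutions and the theorem *)

Definition dipole j c : R[i] := (c == T j)%:R - (c == (T j).+1)%:R.

(** Every block has at least two elements, so a dipole never straddles two
    blocks. *)
Lemma first_childSP j x : ((T j).+1 \in children x) = (T j \in children x).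
Proof.
have w : ((T j).+1 < T j.+1)%N by rewrite first_childS /width; lia.
apply/idP/idP => [jx|jx].
  have -> : x = j.
    by apply: (children_inj jx); rewrite mem_children w leqnSn.
  by rewrite mem_children leqnn ltn_first_child /=.
have -> : x = j.
  by apply: (children_inj jx); rewrite mem_children leqnn ltn_first_child /=.
by rewrite mem_children w leqnSn.
Qed.

Lemma dipole_sum j x : \sum_(c <- children x) dipole j c = 0.
Proof. by rewrite sumrB !sum_pred1 ?iota_uniq// first_childSP subrr. Qed.

Lemma dipole_before j c : (c < T j)%N -> dipole j c = 0.
Proof. by move=> cj; rewrite /dipole !ltn_eqF// ?subrr// ltnW. Qed.

Lemma dipole_first j : dipole j (T j) = 1.
Proof. by rewrite /dipole eqxx ltn_eqF// subr0. Qed.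

Lemma dipole_le j N : \sum_(0 <= c < N) nsq (dipole j c) <= 2.
Proof.
apply: (@le_trans _ _ (\sum_(0 <= c < N) ((c == T j)%:R + (c == (T j).+1)%:R))).
  apply: ler_sum => c _; rewrite /dipole.
  case: (c == T j); case: (c == (T j).+1);
    rewrite /= ?mulr0n ?mulr1n ?subrr ?subr0 ?sub0r ?nsqN ?nsq0 ?nsq1; lra.
by rewrite big_split/= !sum_pred1 ?iota_uniq// -natrD ler_nat; do 2!case: (_ \in _).
Qed.

Lemma path_forest_eta : (48 <= K)%N -> eta G = +oo%E.
Proof.
move=> K48.
have [f fE] : exists f : nat -> nat -> R[i],
    forall j c, f j c = spread (dipole j) (f j) c.
  have ex j : exists f : nat -> R[i], forall c, f c = spread (dipole j) f c.
    apply: causal_fixpoint; first by constructor; exact: 0.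
    exact: spread_causal.
  by have [f fE] := choice ex; exists f.
have fl2 j : (sqnorm (f j) <= (4 * 2)%R%:E)%E.
  exact: (eigen_sqnorm_le (fE j) K48 (dipole_le j)).
apply: (dimension_infinite (v := f) (e := T)) => [j|j|j k jk].
- apply: ker_adjoint_adjacency.
  + exact: path_forest_locally_finite.
  + by apply/l2P; exists (4 * 2).
  + apply/l2P; exists (4 * 2); apply: le_trans (fl2 j).
    rewrite !sqnormE; apply: le_esum => x _.
    by rewrite nsqM nsq_i mul1r.
  + by apply: eigen_adjacency; [exact: fE|exact: dipole_sum].
- rewrite (eigen_first (fE j)) ?dipole_first ?oner_eq0//.
  exact: dipole_before.
- by rewrite (eigen_vanish (fE k) (@dipole_before k))// ltn_first_child.
Qed.

End TheGraph.
End Combinatorics.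

Theorem proposition2p1 (R : realType) (alpha : R) (alpha_gt0 : 0 < alpha) :
  exists (M : R) (G : wgraph R nat),
    1 <= M /\
    graph_connected G /\ graph_simple G /\ graph_locally_finite G /\
    (forall n : nat, adjacent G n n.+1) /\
    (forall n : nat, (0 < n)%N ->
      n%:R `^ (- alpha) * `|(degree G n)%:R - (degree G n.+1)%:R| <= M) /\
    eta G = +oo%E.
Proof.
have K_gt1 : (1 < 48)%N by [].
exists 3, (path_forest K_gt1 R); split; first by rewrite ler1n.
split; first exact: path_forest_connected.
split; first exact: path_forest_simple.
split; first exact: path_forest_locally_finite.
split; first exact: adjacentS.
split; last exact: path_forest_eta.
move=> n n0; rewrite -[leRHS]mul1r ler_pM ?powR_ge0 ?degree_step//.
have : n%:R `^ (- alpha) <= n%:R `^ 0 :> R.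
  by rewrite ler_powR ?ler1n// oppr_le0 ltW.
by rewrite powRr0.
Qed.
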